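(* Let $\lambda$ and $\kappa$ be cardinals with $\lambda>\operatorname{cf}(\lambda)=\kappa$. If there exists a cardinal $\mu<\lambda$ such that $\operatorname{cov}(\lambda,\mu,\kappa,2)=\lambda$, then any poset of cofinality $\lambda$ contains $\lambda^\kappa$ antichains of size $\kappa$.
   Context: A cardinal $\lambda$ with $\lambda>\operatorname{cf}(\lambda)$ is a singular (in particular infinite) cardinal. For a set $A$ and a cardinal $\mu$, $[A]^{<\mu}:=\{X\subseteq A\mid |X|<\mu\}$. For cardinals $\lambda\ge\kappa\ge\sigma>1$ and $\mu\ge\kappa+\aleph_0$, let $$\operatorname{cov}(\lambda,\mu,\kappa,\sigma):=\min\{|D|\mid D\subseteq[\lambda]^{<\mu},\ \forall A\in[\lambda]^{<\kappa}\ \exists B\in[D]^{<\sigma}\ (A\subseteq\bigcup B)\}.$$ (So $\operatorname{cov}(\lambda,\mu,\kappa,2)$ is only defined for $\mu\ge\kappa+\aleph_0$.) Let $\langle P,\le\rangle$ be a poset (partially ordered set). A subset $A\subseteq P$ is cofinal in $P$ iff for every $x\in P$ there is $y\in A$ with $x\le y$; the cofinality $\operatorname{cf}(P,\le)$ of the poset is the least cardinality of a cofinal subset of $P$. Elements $x,y\in P$ are incomparable iff $x\not\le y$ and $y\not\le x$. A subset $A\subseteq P$ is an antichain iff $x,y$ are incomparable for all distinct $x,y\in A$. ''Contains $\lambda^\kappa$ antichains of size $\kappa$'' means that there is a family of $\lambda^\kappa$ many distinct antichains in $P$, each of cardinality $\kappa$. *)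

(* Defs.v *)
From mathcomp Require Import all_boot all_order.
From mathcomp Require Import mathcomp_extra boolp classical_sets functions.
From mathcomp Require Import cardinality wochoice.

Set Implicit Arguments.
Unset Strict Implicit.
Unset Printing Implicit Defensive.

Local Open Scope classical_set_scope.
Local Open Scope card_scope.

(* A cardinal is represented by any type having that cardinality: a variable
   L : Type stands for the cardinal of [set: L], and cardinals are compared
   with the relations #<=, #= and #<.  Cardinal-valued operations defined as a
   minimum (cofinality, cov) are relations whose last argument is the value. *)

Definition card_lt T U (A : set T) (B : set U) : Prop :=
  A #<= B /\ ~ (B #<= A).
Notation "A '#<' B" := (card_lt A B) (at level 79) : card_scope.

(* K = min { |X| : X in F } *)
Definition is_min_card T (F : set (set T)) (K : Type) : Prop :=
  (exists2 X, F X & X #= [set: K]) /\ (forall X, F X -> [set: K] #<= X).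

(* [A]^{<M} *)
Definition subsets_lt T (A : set T) (M : Type) : set (set T) :=
  [set X | X `<=` A /\ X #< [set: M]].

Definition cofinal T (le : rel T) (A : set T) : Prop :=
  forall x, exists2 y, A y & le x y.

Definition is_cofinality T (le : rel T) (K : Type) : Prop :=
  is_min_card [set A | cofinal le A] K.

(* R orders L as its initial ordinal: a well-order all of whose proper initial
   segments have cardinality less than that of L. *)
Definition initial_well_order L (R : rel L) : Prop :=
  well_order R /\ forall x, [set y | R y x /\ y <> x] #< [set: L].

(* cf(L) = K.  Initial well-orders of L are pairwise isomorphic, so the choice
   of R is immaterial. *)
Definition is_cf (L K : Type) : Prop :=
  exists2 R : rel L, initial_well_order R & is_cofinality R K.

Definition cov_family (L M K S : Type) (D : set (set L)) : Prop :=
  D `<=` subsets_lt [set: L] M /\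
  forall A, subsets_lt [set: L] K A ->
    exists2 B : set (set L), subsets_lt D S B & A `<=` \bigcup_(X in B) X.

(* cov(L, M, K, S) is defined, i.e. L >= K >= S > 1 and M >= K + aleph_0, and
   its value is N. *)
Definition is_cov (L M K S N : Type) : Prop :=
  [/\ [set: K] #<= [set: L], [set: S] #<= [set: K],
      [set: unit] #< [set: S], [set: K + nat] #<= [set: M]
    & is_min_card [set D | @cov_family L M K S D] N].

Definition antichain (d : Order.disp_t) (P : porderType d) (A : set P) : Prop :=
  forall x y, A x -> A y -> x <> y -> (x >< y)%O.

(* Main.v *)
(* Transport the order along a bijection q between L and a cofinal subset, so
   that no set of size < |L| is cofinal in L.  Fix a cov family D of size |L|
   and write it as an increasing union of |K| pieces, each of size < |L|.  For
   a piece F and a size bound I < |L|, iterate |M| times: choose p_t outside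
   the sets of size <= |I| dominating what is not above B \ down{p_s : s < t},
   for all bad B in F.  Each B in F has fewer than |M|
   elements, so it is not bad at some stage.  Collecting the p's over all pieces gives S with |S| < |L| such
   that, for A disjoint from down(S) with |A| < |K|, the complement of up(A)
   cannot be dominated by fewer than |L| elements: A lies in some B in D.  So A
   has |L| possible one-point extensions to an antichain, and a recursion of
   length |K| maps K -> L injectively to antichains of size |K|. *)

Require Import Defs.
From HB Require Import structures.
From mathcomp Require Import all_boot all_order.
From mathcomp Require Import mathcomp_extra boolp classical_sets functions.
From mathcomp Require Import cardinality wochoice.

Set Implicit Arguments.
Unset Strict Implicit.

Local Open Scope classical_set_scope.
Local Open Scope card_scope.

(** * Injections and cardinal comparison *)

(** Choice turns [r] into a function, which the second hypothesis makes injective on [A]. With a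
    relation, later injections can be given by cases. *)
Lemma card_le_rel T U (A : set T) (B : set U) (r : T -> U -> Prop) :
    (forall x, A x -> exists2 y, B y & r x y) ->
    (forall x x' y, A x -> A x' -> B y -> r x y -> r x' y -> x = x') ->
  A #<= B.
Proof.
move=> ex_r inj_r.
have [->|/set0P[x0 /ex_r[u0 _ _]]] := eqVneq A set0; first exact: card_ge0.
have /choice[f fP] : forall x, exists y, A x -> B y /\ r x y.
  by move=> x; have [/ex_r[y By rxy]|nAx] := pselect (A x); [exists y|exists u0].
have finj : {in A &, injective f}.
  move=> x x' /set_mem Ax /set_mem Ax' fxx'.
  have [[Bf rf] [_ rf']] := (fP _ Ax, fP _ Ax').
  by apply: inj_r Bf rf _ => //; rewrite fxx'.
have /card_eqPle[_ le_f] := inj_card_eq finj.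
by apply: card_le_trans le_f (subset_card_le _) => _ [x /fP[Bf _] <-].
Qed.

Lemma card_le_fun T U (A : set T) (B : set U) (u0 : U) : A #<= B ->
  exists f : T -> U, (forall x, A x -> B (f x)) /\
    (forall x y, A x -> A y -> f x = f y -> x = y).
Proof.
pose U' : pointedType :=
  HB.pack U (gen_eqMixin U) (gen_choiceMixin U) (isPointed.Build U u0).
move=> /(@pcard_leP T U' A B)/injfunPex[f fB finj].
by exists f; split=> // x y Ax Ay; apply: finj; apply/mem_set.
Qed.

Lemma card_le_setX T U T' U' (A : set T) (B : set U) (A' : set T') (B' : set U') :
  A #<= A' -> B #<= B' -> A `*` B #<= A' `*` B'.
Proof.
have [->|/set0P[[a b] [Aa Bb]]] := eqVneq (A `*` B) set0.
  by move=> _ _; exact: card_ge0.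
move=> leA leB.
have [a' _] : A' !=set0.
  by apply/set0P/eqP => A'0; move: leA Aa; rewrite A'0 card_le0 => /eqP->.
have [b' _] : B' !=set0.
  by apply/set0P/eqP => B'0; move: leB Bb; rewrite B'0 card_le0 => /eqP->.
have [f [fA finj]] := card_le_fun a' leA.
have [g [gB ginj]] := card_le_fun b' leB.
apply: (@card_le_rel _ _ _ _ (fun p q => q = (f p.1, g p.2))).
  by move=> p [Ap Bp]; exists (f p.1, g p.2) => //; split; [apply: fA|apply: gB].
move=> [x y] [x' y'] _ [/= Ax By] [/= Ax' By'] _ -> [/finj-> // /ginj-> //].
Qed.

(** Send [x] to [(i, g i x)] for some [i] with [F i x]; injectivity of [g i] on [F i] recovers
    [x]. *)
Lemma card_bigcup_le I T U (D : set I) (F : I -> set T) (B : set U) :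
  (forall i, D i -> F i #<= B) -> \bigcup_(i in D) F i #<= D `*` B.
Proof.
move=> leF.
have [->|/set0P[x0 [i0 Di0 Fx0]]] := eqVneq (\bigcup_(i in D) F i) set0.
  exact: card_ge0.
have [b0 _] : B !=set0.
  by apply/set0P/eqP => B0; move: (leF _ Di0) Fx0; rewrite B0 card_le0 => /eqP->.
have /choice[g gP] : forall i, exists g : T -> U, D i ->
    (forall x, F i x -> B (g x)) /\
    (forall x y, F i x -> F i y -> g x = g y -> x = y).
  move=> i; have [/leF/(card_le_fun b0)[g ?]|nD] := pselect (D i); first by exists g.
  by exists (fun=> b0).
apply: (@card_le_rel _ _ _ _ (fun x p => F p.1 x /\ p.2 = g p.1 x)).
  move=> x [i Di Fx]; have [gB _] := gP _ Di.
  by exists (i, g i x) => //; split=> //=; apply: gB.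
move=> x x' [i y] _ _ [/= Di _] [Fx ->] [Fx' e].
by have [_ ginj] := gP _ Di; exact: ginj.
Qed.

(** * Well-founded recursion, well-orders, comparability of cardinals *)

(** The step function sees only the set of earlier values, not their indexing, so equal histories
    lead to equal choices. *)
Lemma set_recursion T U (lt : T -> T -> Prop) (G : T -> set U -> U) :
  well_founded lt ->
  exists f : T -> U, forall x, f x = G x (f @` [set y | lt y x]).
Proof.
move=> wf.
pose H x (rec : forall y, lt y x -> U) :=
  G x [set u | exists y, exists h : lt y x, rec y h = u].
exists (Fix wf (fun=> U) H) => x; rewrite Fix_eq; last first.
  move=> {}x f g fg; rewrite /H; congr (G x _); apply/seteqP; split=> u /=;
  by case=> y [h <-]; exists y, h; rewrite fg.
rewrite {1}/H; congr (G x _); apply/seteqP; split=> u /=.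
  by case=> y [h <-]; exists y.
by case=> y h <-; exists y, h.
Qed.

Definition trichotomous T (lt : T -> T -> Prop) : Prop :=
  forall x y, x <> y -> lt x y \/ lt y x.

(** Map the elements of [A] recursively to fresh elements of [B]. If this gets stuck at [x], the
    images of the earlier elements exhaust [B]. *)
Lemma card_le_well_founded T U (lt : T -> T -> Prop) (A : set T) (B : set U) :
    well_founded lt -> trichotomous lt ->
  A #<= B \/ exists2 x, A x & B #<= A `&` [set y | lt y x].
Proof.
move=> wf tri.
have [|no_x] := pselect (exists2 x, A x & B #<= A `&` [set y | lt y x]).
  by right.
left; have [->|/set0P[x0 Ax0]] := eqVneq A set0; first exact: card_ge0.
have [u0 Bu0] : B !=set0.
  apply: contrapT => /set0P/negP/negPn/eqP B0.
  by apply: no_x; exists x0; rewrite ?B0 ?card_ge0.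
have /choice[g gP] : forall S : set U, exists u, ~ (B `<=` S) -> (B `\` S) u.
  move=> S; have [BS|/existsNP[u /not_implyP[Bu Su]]] := pselect (B `<=` S).
    by exists u0.
  by exists u.
(* Restricting to predecessors in [A] keeps values at points outside [A] out of the history. *)
have wf' : well_founded (fun y x => A y /\ lt y x).
  move=> x; elim: (wf x) => {}x _ IH; apply: Acc_intro => y [_ /IH //].
have [h hE] := set_recursion (fun=> g) wf'.
have hP x : A x -> (B `\` (h @` (A `&` [set y | lt y x]))) (h x).
  move=> Ax; rewrite hE; apply: gP => sB; apply: no_x; exists x => //.
  exact: card_le_trans (subset_card_le sB) (card_image_le _ _).
apply: (@card_le_rel _ _ _ _ (fun x u => u = h x)).
  by move=> x Ax; exists (h x) => //; have [] := hP _ Ax.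
move=> x x' _ Ax Ax' _ -> hxx'; apply: contrapT => /tri[lt_xx'|lt_x'x].
  by have [_ []] := hP _ Ax'; exists x.
by have [_ []] := hP _ Ax; exists x'.
Qed.

(** Each property is read off the least element of a set of at most three points; antisymmetry uses
    its uniqueness. *)
Lemma well_order_strict T (R : rel T) : well_order R ->
  [/\ reflexive R, transitive R, total R & antisymmetric R].
Proof.
move=> wo.
have min2 x y : exists z, [/\ z = x \/ z = y, R z x & R z y].
  have [|z [[/asboolP zxy lb] _]] := wo [pred z | `[< z = x \/ z = y >]].
    by exists x; apply/asboolP; left.
  by exists z; split=> //; apply: lb; apply/asboolP; [left|right].
have Rxx : reflexive R by move=> x; have [z [[]->]] := min2 x x.
have Rtot : total R.
  by move=> x y; have [z [[]-> Rx Ry]] := min2 x y; rewrite ?Rx ?Ry ?orbT.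
have Ranti : antisymmetric R.
  move=> x y /andP[Rxy Ryx].
  have [|z [_ Uz]] := wo [pred z | `[< z = x \/ z = y >]].
    by exists x; apply/asboolP; left.
  have <- : z = x.
    by apply: Uz; split; [apply/asboolP; left|move=> t /asboolP[] ->].
  by apply: Uz; split; [apply/asboolP; right|move=> t /asboolP[] ->].
split=> // y x z Rxy Ryz.
have [|t [[/asboolP tP lb] _]] := wo [pred t | `[< [\/ t = x, t = y | t = z] >]].
  by exists x; apply/asboolP; constructor.
have [Rtx Rty Rtz] : [/\ R t x, R t y & R t z].
  by split; apply: lb; apply/asboolP; auto using Or31, Or32, Or33.
case: tP => e; subst t => //; first by rewrite (Ranti x y) ?Rxy.
by rewrite (Ranti y z) ?Ryz // in Rxy.
Qed.

Definition strict T (R : rel T) (y x : T) : Prop := ~~ R x y.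

Lemma wf_strict T (R : rel T) : well_order R -> well_founded (strict R).
Proof.
move=> wo x; apply: contrapT => nAx.
have [|z [[/asboolP nAz lb] _]] := wo [pred z | `[< ~ Acc (strict R) z >]].
  by exists x; apply/asboolP.
apply: nAz; apply: Acc_intro => y /negP ltyz; apply: contrapT => nAy.
by apply: ltyz; apply: lb; apply/asboolP.
Qed.

Lemma strict_trichotomous T (R : rel T) : well_order R -> trichotomous (strict R).
Proof.
move=> /well_order_strict[_ _ Rtot Ranti] x y nxy; rewrite /strict.
apply/orP; rewrite -negb_and; apply/negP => Rxy.
by apply: nxy; apply: Ranti; rewrite andbC.
Qed.

Lemma strict_trans T (R : rel T) x y z : well_order R ->
  strict R x y -> strict R y z -> strict R x z.
Proof.
move=> /well_order_strict[_ Rtr Rtot _] /negP nRyx /negP nRzy.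
apply/negP => Rzx; apply: nRyx; apply: Rtr Rzx.
by case/orP: (Rtot y z).
Qed.

Lemma exists_well_order T : exists R : rel T, well_order R.
Proof. by have [R] := well_ordering_principle {classic T}; exists R. Qed.

Lemma card_le_total T U (A : set T) (B : set U) : A #<= B \/ B #<= A.
Proof.
have [R wo] := exists_well_order T.
have [|[x _ le]] :=
  card_le_well_founded A B (wf_strict wo) (strict_trichotomous wo); first by left.
by right; apply: card_le_trans le (subset_card_le _) => y [].
Qed.

Lemma card_leNgt T U (A : set T) (B : set U) : ~ (A #<= B) -> B #<= A.
Proof. by have [|//] := card_le_total A B. Qed.

(** * The square of an infinite cardinal *)

(** Hilbert's hotel: shift a copy of the natural numbers inside [A] by one. *)
Lemma card_setU1_infinite T (A : set T) (x : T) : infinite_set A -> x |` A #<= A.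
Proof.
move=> infA.
have [f [fA finj]] := card_le_fun x ((infiniteP A).1 infA).
have [Ax|nAx] := pselect (A x).
  by apply: subset_card_le => y [->|].
pose r (y z : T) := [\/ y = x /\ z = f 0%N,
  exists2 n, y = f n & z = f n.+1 | [/\ y <> x, ~ range f y & z = y]].
have fx n : f n <> x by move=> e; apply: nAx; rewrite -e; exact: fA.
have {}finj m n : f m = f n -> m = n by exact: finj.
apply: (@card_le_rel _ _ _ _ r); rewrite /r.
  move=> y xAy; have [->|nyx] := pselect (y = x).
    by exists (f 0%N); [apply: fA|constructor 1].
  have [[n _ <-]|nf] := pselect (range f y).
    by exists (f n.+1); [apply: fA|constructor 2; exists n].
  by exists y; [case: xAy|constructor 3].
move=> y y' z _ _ _ [[-> ->]|[n -> ->]|[_ nf ->]].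
- by case=> [[-> //]|[n _ /finj //]|[_ nf' e]]; case: nf'; rewrite -e; exists 0%N.
- case=> [[_ /finj //]|[m -> /finj[->] //]|[_ nf' e]].
  by case: nf'; rewrite -e; exists n.+1.
- case=> [[_ e]|[m _ e]|[]//]; case: nf; rewrite e; first by exists 0%N.
  by exists m.+1.
Qed.

Lemma infinite_card_lt T U (A : set T) (B : set U) :
  infinite_set A -> finite_set B -> ~ (A #<= B).
Proof. by move=> infA finB /card_le_finite/(_ finB). Qed.

Section Square.
Variables (T : Type) (R : rel T).
Hypothesis wo : well_order R.

Let mx (p : T * T) := if R p.1 p.2 then p.2 else p.1.

(** Gödel's order on pairs, by the larger coordinate first; [W] only breaks ties. *)
Let lt2 (W : rel (T * T)) p q :=
  strict R (mx p) (mx q) \/ mx p = mx q /\ strict W p q.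

Let wf_lt2 W : well_order W -> well_founded (lt2 W).
Proof.
move=> woW q; move: {2}(mx q) (erefl (mx q)) => m.
elim: (wf_strict wo m) q => {}m _ IHm q.
elim: (wf_strict woW q) => {}q _ IHq mq.
by apply: Acc_intro => p [lt_pq|[epq lt_pq]];
  [apply: IHm (erefl _); rewrite -mq|apply: IHq; rewrite ?epq].
Qed.

Let lt2_trichotomous W : well_order W -> trichotomous (lt2 W).
Proof.
move=> woW p q npq; have [e|] := pselect (mx p = mx q).
  by have [] := strict_trichotomous woW npq; [left|right]; right.
by move=> /(strict_trichotomous wo)[]; [left|right]; left.
Qed.

(** If [A] embeds in one of its proper segments, the hypothesis on segments suffices. Otherwise,
    were [A * A] not at most [A], some segment of pairs would have size at least that of [A], though
    it fits in the square of a smaller set. *)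
Lemma card_square_step (A : set T) :
    (forall x, A x -> infinite_set (A `&` [set y | strict R y x]) ->
      (A `&` [set y | strict R y x]) `*` (A `&` [set y | strict R y x])
        #<= A `&` [set y | strict R y x]) ->
  infinite_set A -> A `*` A #<= A.
Proof.
move=> IH infA; have [Rxx Rtr Rtot Ranti] := well_order_strict wo.
have [[x Ax leA]|nA] :=
    pselect (exists2 x, A x & A #<= A `&` [set y | strict R y x]).
  apply: card_le_trans (card_le_setX leA leA) _.
  apply: card_le_trans (IH x Ax _) (subset_card_le _); last by move=> y [].
  by move=> /(card_le_finite leA).
have [W woW] := exists_well_order (T * T)%type.
have [//|[q [Aq1 Aq2] leA]] :=
  card_le_well_founded (A `*` A) A (wf_lt2 woW) (lt2_trichotomous woW).
exfalso; pose m := mx q.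
have Am : A m by rewrite /m /mx; case: ifP.
pose C := A `&` [set y | strict R y m].
(* Pairs before [q] have both coordinates at most [m]; the value [m] may occur, hence the added
   point. *)
have sub : (A `*` A) `&` [set p | lt2 W p q] `<=` (m |` C) `*` (m |` C).
  move=> p [[Ap1 Ap2] lt_pq].
  have Rpm : R (mx p) m.
    case: lt_pq => [/negP nR|[-> _] //].
    by case/orP: (Rtot m (mx p)).
  have [Rp1 Rp2] : R p.1 m /\ R p.2 m.
    move: Rpm; rewrite /mx; case: ifPn => [R12 R2|nR12 R1]; split => //.
      exact: Rtr R2.
    by apply: Rtr R1; have := Rtot p.1 p.2; rewrite (negbTE nR12).
  have inC y : A y -> R y m -> (m |` C) y.
    move=> Ay Rym; have [->|nym] := pselect (y = m); first by left.
    right; split=> //; apply/negP => Rmy; apply: nym; apply: Ranti.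
    by rewrite Rym.
  by split; apply: inC.
have {}leA := card_le_trans leA (subset_card_le sub).
have [finC|infC] := pselect (finite_set C).
  apply: (infinite_card_lt infA _ leA).
  by apply: finite_setX; rewrite finite_setU; split=> //; apply: finite_set1.
have leC := card_setU1_infinite m infC.
apply: nA; exists m => //; apply: card_le_trans leA _.
exact: card_le_trans (card_le_setX leC leC) (IH _ Am infC).
Qed.

End Square.

Theorem card_square T (A : set T) : infinite_set A -> A `*` A #<= A.
Proof.
have [R wo] := exists_well_order T.
have [_ Rtr _ _] := well_order_strict wo.
apply: (card_square_step wo) => x _.
elim: (wf_strict wo x) => {}x _ IHx; apply: (card_square_step wo) => y [Ay ltyx].
suff -> : A `&` [set y | strict R y x] `&` [set z | strict R z y] =
  A `&` [set z | strict R z y] by apply: IHx.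
rewrite -setIA; congr (_ `&` _); apply/seteqP; split=> z; first by case.
move=> ltzy; split=> //; exact: strict_trans wo ltzy ltyx.
Qed.

(** * Sets of size less than that of [L] *)

Section Small.
Variable L : Type.
Hypothesis L_infinite : infinite_set [set: L].

Definition small T (X : set T) : Prop := ~ ([set: L] #<= X).

Lemma card_lt_small T (X : set T) : X #< [set: L] -> small X.
Proof. by case. Qed.

Lemma small_le T U (X : set T) (Y : set U) : X #<= Y -> small Y -> small X.
Proof. by move=> leXY smY /card_le_trans/(_ leXY). Qed.

Lemma small_finite T (X : set T) : finite_set X -> small X.
Proof. exact: infinite_card_lt. Qed.

Lemma small_setX T U (X : set T) (Y : set U) : small X -> small Y -> small (X `*` Y).
Proof.
have square V (Z : set V) : small Z -> small (Z `*` Z).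
  move=> smZ; have [finZ|infZ] := pselect (finite_set Z).
    exact/small_finite/finite_setX.
  exact: small_le (card_square infZ) smZ.
move=> smX smY; have [leXY|leYX] := card_le_total X Y.
  by apply: small_le (card_le_setX leXY (card_lexx _)) (square _ _ smY).
by apply: small_le (card_le_setX (card_lexx _) leYX) (square _ _ smX).
Qed.

Lemma small_setU T (X Y : set T) : small X -> small Y -> small (X `|` Y).
Proof.
move=> smX smY; have sub : X `|` Y `<=` \bigcup_b (if b then X else Y).
  by move=> x [Xx|Yx]; [exists true|exists false].
apply: small_le (subset_card_le sub) _.
have [le|le] := card_le_total X Y.
  apply: small_le (@card_bigcup_le _ _ _ _ _ Y _) _; first by case.
  by apply: small_setX => //; apply: small_finite; exact: finite_finset.
apply: small_le (@card_bigcup_le _ _ _ _ _ X _) _; first by case.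
by apply: small_setX => //; apply: small_finite; exact: finite_finset.
Qed.

Lemma small_closed_segment (R : rel L) c :
  initial_well_order R -> small [set y | R y c].
Proof.
move=> [_ /(_ c)/card_lt_small smc].
have smU := small_setU (small_finite (finite_set1 c)) smc.
apply: small_le (subset_card_le _) smU => y /= Ryc.
by have [->|nyc] := pselect (y = c); [left|right].
Qed.

(** Otherwise [L], the union of the segments below points of [C], would have at most |C| |Y| < |L|
    elements. *)
Lemma small_le_segment (R : rel L) (C : set L) T (Y : set T) :
    small C -> cofinal R C -> small Y ->
  exists2 c, C c & Y #<= [set y | R y c].
Proof.
move=> smC cofC smY; apply: contrapT => noc.
apply: (small_setX smC smY).
apply: card_le_trans (card_bigcup_le (F := fun c => [set y | R y c]) _).
  by apply: subset_card_le => x _; have [c Cc Rxc] := cofC x; exists c.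
by move=> c Cc; apply: card_leNgt => leY; apply: noc; exists c.
Qed.

End Small.

(** * Initial well-orders *)

(** If some proper segment has the size of [K], take the least [x] with such a segment and pull the
    order back along an injection of [K] into it. *)
Lemma exists_initial_order K : exists lt : K -> K -> Prop,
  [/\ well_founded lt, trichotomous lt, forall x y z, lt x y -> lt y z -> lt x z
    & forall x, ~ ([set: K] #<= [set y | lt y x])].
Proof.
have [R wo] := exists_well_order K.
have wf := wf_strict wo.
have tri := strict_trichotomous wo.
have tr x y z := @strict_trans _ _ x y z wo.
have [[x leK]|noK] := pselect (exists x, [set: K] #<= [set y | strict R y x]).
  elim: (wf x) leK => {}x _ IHx leK.
  have [[y ltyx leKy]|min_x] :=
    pselect (exists2 y, strict R y x & [set: K] #<= [set z | strict R z y]).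
    exact: IHx ltyx leKy.
  have [f [ltf finj]] := card_le_fun x leK.
  exists (fun y z => strict R (f y) (f z)); split.
  - move=> y; move: {2}(f y) (erefl (f y)) => u.
    elim: (wf u) y => {}u _ IHu y yu; apply: Acc_intro => z ltzy.
    by apply: (IHu (f z)) => //; rewrite -yu.
  - by move=> y z nyz; apply: tri => /finj-/(_ I I).
  - by move=> y z t; exact: tr.
  move=> y leKy; apply: min_x; exists (f y); first exact: ltf.
  apply: card_le_trans leKy _.
  apply: (@card_le_rel _ _ _ _ (fun z t => t = f z)).
    by move=> z ltz; exists (f z).
  by move=> z z' t _ _ _ -> /finj->.
by exists (strict R); split=> // x leK; apply: noK; exists x.
Qed.

(** * Domination and the escape argument *)

Section Unbounded.
Variables (L : Type) (le : L -> L -> Prop).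
Hypothesis L_infinite : infinite_set [set: L].
Hypothesis le_refl : forall x, le x x.
Hypothesis unbounded :
  forall Y : set L, small L Y -> exists x, forall y, Y y -> ~ le x y.

Definition not_below (S : set L) : set L := [set x | forall y, S y -> ~ le x y].
Definition not_above (S : set L) : set L := [set x | forall y, S y -> ~ le y x].

(** The bad sets of the opening sketch are those for which [large] fails; [I] enters only through
    its cardinality. *)
Definition large (I A : set L) : Prop :=
  forall Y : set L, Y #<= I -> not_below Y `&` not_above A !=set0.

Lemma large_subset I A A' : A `<=` A' -> large I A' -> large I A.
Proof.
move=> sub lA Y /lA[x [nbx nax]]; exists x; split=> // a /sub; exact: nax.
Qed.

Lemma not_below_subset S S' : S `<=` S' -> not_below S' `<=` not_below S.
Proof. by move=> sub x nbx y /sub; exact: nbx. Qed.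

(** Each bad [B] has a witness [Z B] of size at most |I|. The union of these witnesses is small, so
    some [p] is below none of their points; such a [p] must lie above a point of what remains of
    each bad [B]. *)
Lemma escape_step (I : set L) (F : set (set L)) (S : set L) :
    small L I -> small L F ->
  exists p, forall B, F B -> ~ large I (B `&` not_below S) ->
    exists2 b, (B `&` not_below S) b & le b p.
Proof.
move=> smI smF.
have /choice[Z ZP] : forall B, exists Z : set L,
    ~ large I (B `&` not_below S) -> Z #<= I /\
      forall x, not_below Z x -> exists2 b, (B `&` not_below S) b & le b x.
  move=> B; have [lB|/existsNP[Z /not_implyP[leZ nZ]]] :=
    pselect (large I (B `&` not_below S)); first by exists set0.
  exists Z => _; split=> // x nbx; apply: contrapT => nb; apply: nZ.
  by exists x; split=> // b Bb lebx; apply: nb; exists b.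
pose F' := F `&` [set B | ~ large I (B `&` not_below S)].
have leU : \bigcup_(B in F') Z B #<= F' `*` I.
  by apply: card_bigcup_le => B [_ /ZP[]].
have smF' : small L F' by apply: small_le (subset_card_le _) smF => B [].
have [p nbp] := unbounded (small_le leU (small_setX L_infinite smF' smI)).
exists p => B FB nB; have [_] := ZP _ nB; apply=> z Zz.
by apply: nbp; exists B.
Qed.

(* Whenever [B] is still bad at a stage of the recursion, the next point
   [p t] captures a fresh element of [B]; since [M] has more stages than [B] has
   elements, [B] is good at some stage, hence from then on. *)
Lemma escape (M : Type) (I : set L) (F : set (set L)) :
    small L I -> small L F -> (forall B, F B -> ~ ([set: M] #<= B)) ->
  exists2 S : set L, S #<= [set: M] &
    forall B, F B -> large I (B `&` not_below S).
Proof.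
move=> smI smF smB.
have /choice[G GP] := fun S => @escape_step I F S smI smF.
have [R wo] := exists_well_order M.
have [p pE] := set_recursion (fun=> G) (wf_strict wo).
exists (range p); first exact: card_image_le.
move=> B FB; apply: contrapT => nlB; apply: (smB B FB).
pose S t := p @` [set s | strict R s t].
(* [large] passes to subsets, so a set bad at the end was bad at every stage. *)
have nl t : ~ large I (B `&` not_below (S t)).
  apply: contra_not nlB; apply: large_subset => b [Bb nb]; split=> //.
  by apply: not_below_subset nb => _ [s _ <-]; exists s.
have capture t := GP (S t) B FB (nl t).
(* A point captured at stage [t] lies below [p t], so no later stage captures it again. *)
apply: (@card_le_rel _ _ _ _ (fun t b => not_below (S t) b /\ le b (p t))).
  move=> t _; have [b [Bb nb] leb] := capture t.
  by exists b => //; split=> //; rewrite pE.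
move=> t t' b _ _ Bb [nb leb] [nb' leb']; apply: contrapT.
move=> /(strict_trichotomous wo)[lt|lt].
  by apply: nb' leb; exists t.
by apply: nb leb'; exists t'.
Qed.

(** A subfamily with fewer than two members is empty or a singleton. *)
Lemma cov_family_2 (M K : Type) (D : set (set L)) (A : set L) :
    cov_family M K 'I_2 D -> A #< [set: K] ->
  A = set0 \/ exists2 B, D B & A `<=` B.
Proof.
move=> [_ covD] ltA; have [//|Bs [sBs lt2] sub] := covD A.
have [Bs0|/set0P[B BsB]] := eqVneq Bs set0.
  by left; rewrite -subset0; move: sub; rewrite Bs0 bigcup_set0.
right; exists B; first exact: sBs.
move=> a /sub[B' BsB' B'a]; have [<-//|nB] := pselect (B' = B).
case: lt2 => _ []; apply: (@card_le_rel _ _ _ _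
  (fun (i : 'I_2) X => X = if i == ord0 then B else B')).
  by move=> i _; exists (if i == ord0 then B else B') => //; case: ifP.
move=> i j X _ _ _ -> e; apply/val_inj.
case: i j e => [[|[|//]] ?] [[|[|//]] ?] //= e; by case: nB.
Qed.

(** The segment [seg c] plays two roles: it bounds the size of the piece [F c] of [D], and it is the
    size bound on the dominating sets for that piece. *)
Lemma escape_all (R : rel L) (C : set L) (M K : Type) (D : set (set L)) :
    initial_well_order R -> cofinal R C -> small L C -> small L [set: M] ->
    cov_family M K 'I_2 D -> D #<= [set: L] ->
  exists2 S : set L, small L S &
    forall A Y, A `<=` not_below S -> A #< [set: K] -> small L Y ->
      not_below Y `&` not_above A !=set0.
Proof.
move=> iwo cofC smC smM covD leD.
have [x0 _] := infinite_setN0 L_infinite.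
have [j [_ jinj]] := card_le_fun x0 leD.
pose seg c := [set y | R y c].
pose F c := D `&` [set B | seg c (j B)].
have smseg c : small L (seg c) by exact: small_closed_segment.
have smF c : small L (F c).
  apply: small_le (smseg c).
  apply: (@card_le_rel _ _ _ _ (fun B i => i = j B)).
    by move=> B [_ FB]; exists (j B).
  by move=> B B' i [DB _] [DB' _] _ ->; exact: jinj.
have FM c B : F c B -> ~ ([set: M] #<= B).
  by move=> [DB _]; have [sD _] := covD; have [_ []] := sD _ DB.
have /choice[S SP] : forall c, exists S : set L, S #<= [set: M] /\
    forall B, F c B -> large (seg c) (B `&` not_below S).
  by move=> c; have [S ? ?] := escape (smseg c) (smF c) (@FM c); exists S.
exists (\bigcup_(c in C) S c).
  apply: small_le (small_setX L_infinite smC smM).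
  by apply: card_bigcup_le => c _; have [] := SP c.
move=> A Y nbA ltA smY.
have [->|[B DB sAB]] := cov_family_2 covD ltA.
  by have [x nbx] := unbounded smY; exists x; split=> // a [].
have [_ Rtr Rtot _] := well_order_strict iwo.1.
(* [c1] handles the size of [Y], [c2] the piece containing [B]; [c] is the larger of the two. *)
have [c1 Cc1 leY] := small_le_segment L_infinite smC cofC smY.
have [c2 Cc2 Rjc2] := cofC (j B).
have [c [Cc Rc1 Rc2]] : exists c, [/\ C c, R c1 c & R c2 c].
  have [Rxx _ _ _] := well_order_strict iwo.1.
  by case/orP: (Rtot c1 c2) => ?; [exists c2|exists c1].
have FcB : F c B by split=> //; exact: Rtr Rc2.
have sub : A `<=` B `&` not_below (S c).
  move=> a Aa; split; first exact: sAB.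
  by apply: not_below_subset (nbA a Aa) => x; exists c.
apply: (large_subset sub ((SP c).2 B FcB)).
by apply: card_le_trans leY (subset_card_le _) => y Ry; exact: Rtr Rc1.
Qed.

(** * Construction of the antichains *)

(* Requiring new points to exceed the old ones in [R] makes the increasing
   enumeration of the antichain, hence its code, recoverable from the set. *)
Definition candidates (R : rel L) (S A : set L) : set L :=
  [set x | [/\ not_below S x, not_below A x, not_above A x
             & forall a, A a -> strict R a x]].

(** If there were few candidates, they could be put into the set to be escaped; the escaping point
    would be a candidate and yet not below itself. *)
Lemma card_candidates (R : rel L) (K : Type) (S A : set L) :
    initial_well_order R -> (forall X, cofinal R X -> [set: K] #<= X) ->
    [set: K] #< [set: L] -> small L S ->
    (forall A Y, A `<=` not_below S -> A #< [set: K] -> small L Y ->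
      not_below Y `&` not_above A !=set0) ->
  A `<=` not_below S -> A #< [set: K] -> [set: L] #<= candidates R S A.
Proof.
move=> iwo cofK ltKL smS escS nbA ltA; apply: contrapT => smc.
have [Rxx Rtr Rtot _] := well_order_strict iwo.1.
have smA : small L A by apply: small_le ltA.1 (card_lt_small ltKL).
(* Having fewer than |K| points, [A] is not cofinal in [R]. *)
have [m Am] : exists m, forall a, A a -> strict R a m.
  apply: contrapT => nom; apply: ltA.2; apply: cofK => x.
  apply: contrapT => nx; apply: nom; exists x => a Aa; apply/negP => Rxa.
  by apply: nx; exists a.
(* By reflexivity, a point not below [Y] is outside [Y]; the segment up to [m] thus forces it beyond
   [A] in [R]. *)
pose Y := S `|` A `|` [set y | R y m] `|` candidates R S A.
have smY : small L Y.
  apply: small_setU => //; apply: small_setU => //; last exact: small_closed_segment.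
  exact: small_setU.
have [x [nbx nax]] := escS A Y nbA ltA smY.
apply: (nbx x) => //; right; split=> //.
- by move=> s Ss; apply: nbx; do 3 left.
- by move=> a Aa; apply: nbx; do 2 left; right.
- move=> a Aa; apply/negP => Rxa; apply: (nbx x) => //; left; right.
  apply: Rtr Rxa _; case/orP: (Rtot a m) => // Rma.
  by have /negP := Am a Aa.
Qed.

(** At stage [k], the value [f k] selects one of |L| candidates over the points chosen so far. The
    order on [K] is initial, so every history has fewer than |K| points. *)
Lemma antichain_tree (R : rel L) (K : Type) (S : set L) :
    well_order R ->
    (forall A, A `<=` not_below S -> A #< [set: K] ->
      [set: L] #<= candidates R S A) ->
  exists2 X : (K -> L) -> set L, injective X &
    forall f, X f #= [set: K] /\
      forall x y, X f x -> X f y -> x <> y -> ~ le x y.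
Proof.
move=> wo cand.
have [x0 _] := infinite_setN0 L_infinite.
have [lt [wf tri tr smlt]] := exists_initial_order K.
have /choice[g gP] : forall A, exists g : L -> L,
    A `<=` not_below S -> A #< [set: K] ->
    (forall i, candidates R S A (g i)) /\ injective g.
  move=> A; have [[nbA ltA]|nA] := pselect (A `<=` not_below S /\ A #< [set: K]).
    have [g [gc ginj]] := card_le_fun x0 (cand A nbA ltA).
    by exists g => _ _; split=> [i|i j]; [exact: gc|exact: ginj].
  by exists id => *; case: nA.
have /choice[X XE] := fun f : K -> L =>
  set_recursion (fun k A => g A (f k)) wf.
pose before f k := X f @` [set l | lt l k].
have ltK f k : before f k #< [set: K].
  split; first exact: card_le_trans (card_image_le _ _) (card_leT _).
  by move=> /card_le_trans/(_ (card_image_le _ _))/smlt.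
have Xc f k : candidates R S (before f k) (X f k).
  elim: (wf k) => {}k _ IHk; rewrite XE; apply: (gP _ _ (ltK f k)).1.
  by move=> _ [l /IHk[nb _ _ _] <-].
have nbX f k : before f k `<=` not_below S by move=> _ [l _ <-]; case: (Xc f l).
have ginj f k : injective (g (before f k)) := (gP _ (nbX f k) (ltK f k)).2.
have Xlt f k l : lt k l -> strict R (X f k) (X f l).
  by move=> ltkl; have [_ _ _] := Xc f l; apply; exists k.
have Rirr x : ~ strict R x x.
  by have [Rxx _ _ _] := well_order_strict wo; rewrite /strict Rxx.
have Xinj f : injective (X f).
  move=> k l e; apply: contrapT => /tri[] /(Xlt f); rewrite e; exact: Rirr.
exists (fun f => range (X f)).
  move=> f f' eff'; apply: contrapT => nff'.
  have [k nk eqk] : exists2 k, f k <> f' k & forall l, lt l k -> f l = f' l.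
    have [k0 nk0] : exists k, f k <> f' k.
      by apply/existsNP => e; apply: nff'; apply/funext.
    elim: (wf k0) nk0 => {}k0 _ IHk nk0.
    have [[l ltl nl]|nol] := pselect (exists2 l, lt l k0 & f l <> f' l).
      exact: IHk nl.
    by exists k0 => // l ltl; apply: contrapT => nl; apply: nol; exists l.
  have eqX l : lt l k -> X f l = X f' l.
    elim: (wf l) => {}l _ IHl ltl; rewrite !XE eqk //; congr (g _ _).
    apply/seteqP; split=> _ [h lth <-]; exists h => //;
    by rewrite IHl //; exact: tr ltl.
  have ebefore : before f k = before f' k.
    by apply/seteqP; split=> _ [l ltl <-]; exists l => //; rewrite eqX.
  have nX : X f k <> X f' k.
    by rewrite !XE -/(before f k) -/(before f' k) -ebefore => /ginj.
  (* At the first difference, the [R]-smaller value is missing from the other range: there, earlier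
     values belong to the common history, and values from [k] on are too large. *)
  have lost h h' : range (X h) = range (X h') -> before h k = before h' k ->
      ~ strict R (X h k) (X h' k).
    move=> ehh' eb ltk; have [l _ el] : range (X h') (X h k) by rewrite -ehh'; exists k.
    have [e|nlk] := pselect (l = k); first by move: ltk; rewrite -el e; exact: Rirr.
    have [ltlk|ltkl] := tri _ _ nlk.
      have : before h k (X h k) by rewrite eb; exists l.
      by case=> m ltmk /Xinj em; move: (Xlt h _ _ ltmk); rewrite em; exact: Rirr.
    by apply: (Rirr (X h k)); apply: strict_trans wo ltk _; rewrite -el; exact: Xlt.
  by have [|] := strict_trichotomous wo nX; apply: lost.
move=> f; split; first by apply: inj_card_eq => k l _ _; exact: Xinj.
move=> _ _ [k _ <-] [l _ <-] nkl.
have [|ltkl|ltlk] := tri k l; first by move=> e; apply: nkl; rewrite e.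
  by have [_ _ na _] := Xc f l; apply: na; exists k.
by have [_ nb _ _] := Xc f k; apply: nb; exists l.
Qed.

End Unbounded.

(** * Transport between [L] and the poset *)

Theorem theorem1p3 (L K : Type)
    (L_infinite : infinite_set [set: L])
    (cfL : is_cf L K)
    (L_singular : [set: K] #< [set: L])
    (covL : exists M : Type, [set: M] #< [set: L] /\ is_cov L M K 'I_2 L)
    (d : Order.disp_t) (P : porderType d)
    (cfP : is_cofinality (fun x y : P => (x <= y)%O) L) :
  exists F : set (set P),
    F #= [set: K -> L] /\
    forall A : set P, F A -> antichain A /\ A #= [set: K].
Proof.
have [R iwo [[C cofC /card_eqPle[leCK _]] minK]] := cfL.
have [M [ltM [_ _ _ _ [[D covD /card_eqPle[leDL _]] _]]]] := covL.
have [[Q cofQ eQL] minQ] := cfP.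
have [x0 _] := infinite_setN0 L_infinite.
have [p0 _] : Q !=set0.
  apply: contrapT => /set0P/negP/negPn/eqP Q0.
  have /card_eqPle[_] := eQL; rewrite Q0 card_le0 => /eqP L0.
  by have : [set: L] x0 by []; rewrite L0.
pose P' : pointedType :=
  HB.pack (P : Type) (gen_eqMixin P) (gen_choiceMixin P) (isPointed.Build P p0).
have [q [_ qinj qsurj]] : exists q : L -> P, set_bij [set: L] Q q.
  by apply/(@card_set_bijP L P'); exact: card_esym.
have {}qinj : injective q by move=> x y; apply: qinj; rewrite in_setT.
pose le x y : Prop := (q x <= q y)%O.
have le_refl x : le x x by exact: Order.POrderTheory.lexx.
(* A small [Y] that no point escapes would have a cofinal image in [P], against the minimality of
   |L|. *)
have unbounded Y : small L Y -> exists x, forall y, Y y -> ~ le x y.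
  move=> smY; apply: contrapT => nx; apply: smY.
  apply: card_le_trans (minQ (q @` Y) _) (card_image_le _ _) => u.
  have [v Qv leuv] := cofQ u; have [x _ qx] := qsurj _ Qv.
  have [y Yy lexy] : exists2 y, Y y & le x y.
    apply: contrapT => ny; apply: nx; exists x => y Yy lexy.
    by apply: ny; exists y.
  exists (q y); first by exists y.
  by apply: Order.POrderTheory.le_trans lexy; rewrite qx.
have smC : small L C by exact: small_le leCK (card_lt_small L_singular).
have smM : small L [set: M] by exact: card_lt_small.
have [S smS escS] := escape_all L_infinite unbounded iwo cofC smC smM covD leDL.
have [X Xinj XP] := antichain_tree L_infinite iwo.1 (fun A =>
  card_candidates (A := A) L_infinite le_refl iwo minK L_singular smS escS).
exists (range (fun f => q @` X f)); split.
  apply: inj_card_eq => f g _ _ efg; apply: Xinj.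
  apply/seteqP; split=> x Xx.
    have : (q @` X g) (q x) by rewrite -efg; exists x.
    by case=> y Xy /qinj <-.
  have : (q @` X f) (q x) by rewrite efg; exists x.
  by case=> y Xy /qinj <-.
move=> _ [f _ <-]; have [cardX antiX] := XP f; split.
  move=> _ _ [x Xx <-] [y Xy <-] nxy.
  have nxy' : x <> y by move=> e; apply: nxy; rewrite e.
  rewrite /Order.comparable negb_or; apply/andP.
  by split; apply/negP; apply: antiX => // /esym.
by apply: card_eq_trans (inj_card_eq _) cardX => x y _ _; exact: qinj.
Qed.
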